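(* Let $n\ge 2$ be an even integer, let $G_1,\ldots,G_n$ be independent standard Gaussian random variables, and let $X_{(1)}\ge\ldots\ge X_{(n)}$ be the order statistics of $|G_1|,\ldots,|G_n|$. Let $v_n=\frac{8}{n\log 2}$. Then for all $0\le\lambda<\frac{\sqrt{n}}{2\sqrt{v_n}}$, $$\log\mathbb{E}\left[e^{\lambda(X_{(n/2)}-\mathbb{E}X_{(n/2)})}\right]\le\frac{v_n\lambda^2}{2\left(1-2\lambda\sqrt{v_n/n}\right)},$$ and for all $t>0$, $$\mathbb{P}\left\{X_{(n/2)}-\mathbb{E}X_{(n/2)}>\sqrt{2v_nt}+2\sqrt{v_n/n}\;t\right\}\le e^{-t}.$$
   Context: The order statistics are the non-increasing rearrangement of the sample, so $X_{(n/2)}$ is the $(n/2)$-th largest value; $\log$ is the natural logarithm. *)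

(* Defs.v *)
From HB Require Import structures.
From mathcomp Require Import all_boot all_order all_algebra.
From mathcomp Require Import all_classical all_reals all_analysis.

Set Implicit Arguments.
Unset Strict Implicit.
Unset Printing Implicit Defensive.

Import Order.TTheory GRing.Theory Num.Theory.
Import numFieldNormedType.Exports.

Local Open Scope classical_set_scope.
Local Open Scope ring_scope.

(* Mutual independence: the product rule holds for every finite subfamily. *)
Definition mutually_independent (d : measure_display) (T : measurableType d)
    (R : realType) (P : probability T R) (I : finType)
    (X : I -> {RV P >-> R}) : Prop :=
  forall (J : {set I}) (B : I -> set R),
    (forall i, measurable (B i)) ->
    P (\bigcap_(i in [set` J]) (X i @^-1` B i)) =
    (\prod_(i in J) P (X i @^-1` B i))%E.

(* The two laws are compared on Borel sets only: outside the sigma-algebra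
   neither [distribution] nor [normal_prob] has a meaningful value. *)
Definition standard_gaussian (d : measure_display) (T : measurableType d)
    (R : realType) (P : probability T R) (X : {RV P >-> R}) : Prop :=
  forall A : set R, measurable A -> distribution P X A = normal_prob 0 1 A.

(* The rank k is 1-based: k = 1 gives the maximum and k = n the minimum.
   Ranks outside 1..n are not meaningful. *)
Definition order_stat (R : realType) (n : nat) (x : 'I_n -> R) (k : nat) : R :=
  nth 0 (sort >=%R [seq x i | i <- enum 'I_n]) k.-1.

Definition abs_median (d : measure_display) (T : measurableType d)
    (R : realType) (P : probability T R) (n : nat)
    (G : 'I_n -> {RV P >-> R}) (w : T) : R :=
  order_stat (fun i => `|G i w|) n./2.

Definition vn (R : realType) (n : nat) : R := 8 / (n%:R * ln 2).

(* Main.v *)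
(* The cumulative hazard [H = - ln P(|G1| > x)] of the half-normal law has
   derivative at least [2 / sqrt (2 * pi)], so [X] is a Lipschitz function of
   [Y = H X], and [Y] is the median of [n] independent standard exponentials,
   for which [E exp (theta Y)] is the product of [i / (i - theta)] over
   [n / 2 <= i <= n].  Jensen's inequality and an independent copy give
   [E exp (lambda (X - E X)) <= E exp (lambda X) E exp (- lambda X)
     <= E exp (theta Y) E exp (- theta Y)] with [theta = lambda sqrt (pi / 2)],
   because [cosh] is even and increases with the modulus.  The explicit product
   of [i^2 / (i^2 - theta^2)] is then small enough: the constant [8 / ln 2]
   leaves a large margin.  The tail bound is Chernoff's. *)

Require Import Defs.
From mathcomp Require Import all_boot all_order all_algebra.
From mathcomp Require Import all_classical all_reals all_analysis.
From mathcomp Require Import measurable_realfun.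
From mathcomp Require Import ring lra.

Set Implicit Arguments.
Unset Strict Implicit.
Unset Printing Implicit Defensive.

Import Order.TTheory GRing.Theory Num.Theory.
Import numFieldNormedType.Exports.

Local Open Scope classical_set_scope.
Local Open Scope ring_scope.

(** * Order statistics as counts *)

Lemma sorted_ge_nth_pred (R : realType) (p : pred R) (s : seq R) (k : nat) :
  (forall a b, a <= b -> p a -> p b) -> sorted >=%R s -> (k < size s)%N ->
  p (nth 0 s k) = (k < count p s)%N.
Proof.
move=> up; elim: s k => // a s IH k /= as_sorted.
have s_sorted := path_sorted as_sorted.
have le_a : all (fun b => b <= a) s.
  by apply: order_path_min as_sorted => x y z xy yz; exact: le_trans yz xy.
have [pa|pNa] := boolP (p a).
  by case: k => [|k] /=; rewrite ?pa// add1n ltnS => ?; exact: IH.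
(* The head is the largest entry and fails [p], so by [up] every later entry fails too. *)
have -> : count p s = 0%N.
  apply/eqP; rewrite -leqn0 leqNgt -has_count; apply/hasPn => b /(allP le_a) ba.
  by apply: contra pNa; exact: up.
case: k => [|k] /= ks; first by rewrite (negbTE pNa).
apply/negbTE; apply: contra pNa; apply: up.
by apply: (allP le_a); exact: mem_nth.
Qed.

(** In the sorted list the entries satisfying an up-closed [p] form a prefix. Every event about the
    median below is turned into a count through this equality, with [p] a strict or large lower
    bound, or an upper bound on a decreasing function. *)
Lemma order_stat_pred (R : realType) (p : pred R) (n k : nat) (x : 'I_n -> R) :
  (forall a b, a <= b -> p a -> p b) -> (0 < k <= n)%N ->
  p (order_stat x k) = (k <= #|[set i | p (x i)]%SET|)%N.
Proof.
move=> up; case: k => // k /= kn; rewrite /order_stat sorted_ge_nth_pred//.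
- rewrite count_sort count_map cardsE cardE size_filter enumT.
  by rewrite -enumT /enum_mem.
- by apply: sort_sorted => a b; exact: le_total.
- by rewrite size_sort size_map size_enum_ord.
Qed.

Lemma measure_bigcup_finType (d : measure_display) (T : measurableType d)
    (R : realType) (mu : {measure set T -> \bar R}) (I : finType) (Q : pred I)
    (F : I -> set T) :
  (forall i, measurable (F i)) -> trivIset setT F ->
  mu (\bigcup_(i in [set` Q]) F i) = (\sum_(i | Q i) mu (F i))%E.
Proof.
move=> mF tF; rewrite measure_fin_bigcup//; last exact: sub_trivIset tF.
symmetry; apply: bigfs; first exact: index_enum_uniq.
by move=> i _; rewrite mem_index_enum.
Qed.

(** * Binomial law of the number of successes *)

Section success_count.
Context (d : measure_display) (T : measurableType d) (R : realType)
  (P : probability T R) (n : nat) (G : 'I_n -> {RV P >-> R}) (A : set R).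
Hypothesis mA : measurable A.

Let hits w : {set 'I_n} := [set i | G i w \in A]%SET.

Let pattern (J : {set 'I_n}) (i : 'I_n) : set R := if i \in J then A else ~` A.

Let mpattern J i : measurable (pattern J i).
Proof. by rewrite /pattern; case: ifP => // _; exact: measurableC. Qed.

(** Fixing the exact success set constrains every index, by [A] or by its complement; in this form
    independence applies to the full family. *)
Let hitsE J : [set w | hits w = J] =
  \bigcap_(i in [set` [set: 'I_n]%SET]) (G i @^-1` pattern J i).
Proof.
apply/seteqP; split=> [w <- i _|w GJ] /=.
  rewrite /pattern inE; case: ifPn => /=; first by rewrite inE.
  by rewrite notin_setE.
apply/setP => i; rewrite inE.
have := GJ i; rewrite /= inE => /(_ isT); rewrite /pattern.
by case: ifPn => _ /=; [exact: mem_set|exact: memNset].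
Qed.

Let mhits J : measurable [set w | hits w = J].
Proof.
rewrite hitsE; apply: fin_bigcap_measurable => // i _.
by rewrite -[X in measurable X]setTI; exact: measurable_funP.
Qed.

Let count_bigcup k : [set w | (k <= #|[set i | G i w \in A]%SET|)%N] =
  \bigcup_(J in [set J : {set 'I_n} | (k <= #|J|)%N]) [set w | hits w = J].
Proof.
apply/seteqP; split=> [w kw|w [J /= kJ HJ]]; first by exists (hits w).
by rewrite /= -HJ in kJ *.
Qed.

Lemma measurable_count_ge k :
  measurable [set w | (k <= #|[set i | G i w \in A]%SET|)%N].
Proof. by rewrite count_bigcup; exact: fin_bigcup_measurable. Qed.

(** The event is the disjoint union, over index sets [J] with at least [k] elements, of the events
    that the success set is [J]. Independence gives each of these a probability that depends on
    [#|J|] only, and grouping by cardinality produces the binomial coefficients. *)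
Lemma probability_count_ge (p : R) k : mutually_independent G ->
  (forall i, P (G i @^-1` A) = p%:E) ->
  P [set w | (k <= #|[set i | G i w \in A]%SET|)%N] =
  (\sum_(k <= j < n.+1) p ^+ j * (1 - p) ^+ (n - j) *+ 'C(n, j))%:E.
Proof.
move=> G_indep Gp; rewrite count_bigcup.
rewrite (measure_bigcup_finType _ (fun J : {set 'I_n} => (k <= #|J|)%N))//;
  last first.
  by move=> I J _ _ [w [/= <- <-]].
have PJ J : P [set w | hits w = J] = (p ^+ #|J| * (1 - p) ^+ (n - #|J|))%:E.
  rewrite hitsE G_indep//.
  under eq_bigr => i _.
    rewrite (_ : P _ = (if i \in J then p else 1 - p)%:E); first over.
    rewrite /pattern; case: ifP => _ //.
    by rewrite preimage_setC probability_setC ?Gp// -[X in measurable X]setTI;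
       exact: measurable_funP.
  rewrite prodEFin; congr EFin; under eq_bigl do rewrite inE.
  rewrite (bigID (fun i => i \in J))/=; congr (_ * _).
    by under eq_bigr => i -> do []; rewrite prodr_const.
  under eq_bigr => i /negbTE-> do [].
  rewrite prodr_const; congr (_ ^+ _).
  have -> : (n - #|J|)%N = #|(~: J)%SET|.
    by rewrite [RHS]cardsCs finset.setCK card_ord.
  by apply: eq_card => i; rewrite !inE.
rewrite (eq_bigr _ (fun J _ => PJ J)) sumEFin; congr EFin.
rewrite (@big_geq_mkord _ _ _ _ _ xpredT).
have card_lt (J : {set 'I_n}) : (#|J| < n.+1)%N.
  by rewrite ltnS -[X in (_ <= X)%N]card_ord max_card.
rewrite (partition_big (fun J => Ordinal (card_lt J))
  (fun j : 'I_n.+1 => k <= j)%N)//=.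
apply: eq_bigr => j kj.
rewrite (eq_bigl (mem [set J : {set 'I_n} | #|J| == j]%SET)) => [|J]; last first.
  by rewrite !inE -val_eqE/=; apply: andb_idl => /eqP->.
rewrite (eq_bigr (fun=> p ^+ j * (1 - p) ^+ (n - j))) => [|J]; last first.
  by rewrite /= inE => /eqP->.
by rewrite sumr_const card_draws card_ord.
Qed.

End success_count.

(** * Tail and hazard rate of the half-normal law *)

Section absolute_gaussian_tail.
Context {R : realType}.
Local Notation mu := (@lebesgue_measure R).
Local Notation phi := (@normal_pdf R 0 1).

Definition normal_cdf (x : R) : R := (\int[mu]_(t in `]-oo, x]) phi t)%R.

(** For [0 <= x] this is the probability that a standard Gaussian exceeds [x] in modulus. The
    formula also makes sense for negative [x], so that the function is differentiable and strictly
    decreasing on the whole line, without a boundary at 0. *)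
Definition abs_normal_tail (x : R) : R := 1 - normal_cdf x + normal_cdf (- x).

Lemma normal_probNy (x : R) : normal_prob 0 1 `]-oo, x] = (normal_cdf x)%:E.
Proof.
rewrite /normal_cdf /Rintegral fineK//.
exact: (@fin_num_measure _ _ _ (normal_prob 0 1)).
Qed.

Lemma abs_normal_tailE (x : R) : 0 <= x ->
  normal_prob 0 1 [set y : R | x < `|y|] = (abs_normal_tail x)%:E.
Proof.
move=> x0.
have -> : [set y : R | x < `|y|] = ~` `]-oo, x] `|` `]-oo, - x[.
  apply/seteqP; split=> y /=; rewrite !in_itv/= lter_normr.
    by case/orP => xy; [left; rewrite leNgt xy|right; rewrite ltrNr].
  by case=> [/negP|]; rewrite -?ltNge 1?ltrNr => ->; rewrite ?orbT.
rewrite (@measureU _ _ _ (normal_prob 0 1))//; last 2 first.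
- exact: measurableC.
- apply/seteqP; split=> y //= []; rewrite !in_itv/= => /negP; rewrite -ltNge.
  by move=> xy yx; have := lt_trans (lt_trans yx _) xy; rewrite -subr_gt0; lra.
rewrite [X in (X + _)%E](_ : _ = (1 - normal_prob 0 1 `]-oo, x])%E); last first.
  exact: (@probability_setC _ _ _ (normal_prob 0 1)).
rewrite normal_probNy.
(* The endpoint carries no mass, so the open ray may be closed. *)
rewrite [X in (_ + X)%E](_ : _ = normal_prob 0 1 `]-oo, - x]); last first.
  rewrite /=/normal_prob integral_itv_bndo_bndc//.
  apply/measurable_EFinP; apply: measurable_funTS.
  exact: measurable_normal_pdf.
by rewrite normal_probNy.
Qed.

Lemma is_derive_normal_cdf (x : R) : is_derive x 1 normal_cdf (phi x).
Proof.
have x1 : x < x + 1 by rewrite ltrDl.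
have iphi : mu.-integrable `]-oo, x + 1] (EFin \o phi).
  by apply: integrableS (integrable_normal_pdf 0 1).
have cphi : {for x, continuous phi} by apply: continuous_normal_pdf.
have [dF F'] := @continuous_FTC1 R phi -oo%O x _ x1 iphi (ltNyr x) cphi.
by apply: DeriveDef => //; rewrite -derive1E.
Qed.

Let phiE (x : R) : phi x = normal_peak 1 * expR (- (x ^+ 2 / 2)).
Proof.
by rewrite normal_pdfE// /normal_fun subr0 expr1n mulNr.
Qed.

(** The value at 0 of the half-normal density, equal to [sqrt (2 / pi)]. *)
Let kappa : R := 2 * normal_peak 1.

Let kappa_gt0 : 0 < kappa.
Proof. by rewrite mulr_gt0 // normal_peak_gt0. Qed.

Lemma is_derive_abs_normal_tail (x : R) :
  is_derive x 1 abs_normal_tail (- (kappa * expR (- (x ^+ 2 / 2)))).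
Proof.
have dx := is_derive_normal_cdf x.
have dNx := is_derive_normal_cdf (- x).
have dN : is_derive x 1 (fun y : R => - y) (- 1).
  exact: (@is_deriveN _ _ _ id _ _ _ (is_derive_id _ _)).
have dc := @is_derive1_comp _ normal_cdf (fun y : R => - y) x _ _ dNx dN.
have d1 : is_derive x 1 (fun=> 1 : R) 0 by exact: is_derive_cst.
have dJ := is_deriveD (is_deriveB d1 dx) dc.
apply: (@is_derive_eq _ _ _ _ _ _ _ _ dJ); rewrite !phiE sqrrN /kappa.
by ring.
Qed.

Lemma continuous_abs_normal_tail : continuous abs_normal_tail.
Proof.
move=> x; apply: differentiable_continuous.
by apply/derivable1_diffP; have [] := is_derive_abs_normal_tail x.
Qed.

Lemma abs_normal_tail0 : abs_normal_tail 0 = 1.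
Proof. by rewrite /abs_normal_tail oppr0 subrK. Qed.

Lemma abs_normal_tail_decr : {homo abs_normal_tail : x y / x < y >-> y < x}.
Proof.
move=> x y xy; apply: (@ltr0_derive1_decr R abs_normal_tail x y) => //.
- by move=> z _; have [] := is_derive_abs_normal_tail z.
- move=> z _; rewrite derive1E.
  have -> := @derive_val _ _ _ _ _ _ _ (is_derive_abs_normal_tail z).
  by rewrite oppr_lt0 mulr_gt0 ?expR_gt0.
- exact/continuous_subspaceT/continuous_abs_normal_tail.
Qed.

Lemma abs_normal_tail_gt0 x : 0 < abs_normal_tail x.
Proof.
(* A point to the right of [x] at which the tail is a probability, hence non-negative; strict
   decrease gives positivity at [x], even for negative [x]. *)
pose y := Num.max x 0 + 1.
have y0 : 0 <= y by rewrite addr_ge0 // le_max lexx orbT.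
have xy : x < y.
  by rewrite (@le_lt_trans _ _ (Num.max x 0)) ?le_max ?lexx// ltrDl.
apply: le_lt_trans (abs_normal_tail_decr xy).
by rewrite -lee_fin -abs_normal_tailE// (@measure_ge0 _ _ _ (normal_prob 0 1)).
Qed.

Lemma cvg_abs_normal_tail : abs_normal_tail x @[x --> +oo] --> 0.
Proof.
(* The modulus is viewed as a random variable under the normal law: its complementary distribution
   function tends to 0 and agrees with [abs_normal_tail] on non-negative reals. *)
have mabs : measurable_fun setT (fun x : measurableTypeR R => `|x| : R).
  exact: normr_measurable.
pose A : {RV (normal_prob (0 : R) 1) >-> R} := mfun_Sub (mem_set mabs).
have /fine_cvgP[_] := @cvg_ccdfy0 _ _ R (normal_prob 0 1) A.
apply: cvg_trans; apply: near_eq_cvg.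
near=> x; rewrite /= /ccdf /distribution /pushforward.
rewrite [X in fine X](_ : _ = normal_prob 0 1 [set y : R | x < `|y|]).
  by rewrite abs_normal_tailE//; near: x; exact: nbhs_pinfty_ge.
by congr (normal_prob 0 1); apply/seteqP; split=> y /=; rewrite in_itv/= andbT.
Unshelve. all: by end_near. Qed.

Let is_derive_gauss (x : R) : is_derive x 1 (fun y : R => expR (- (y ^+ 2 / 2)))
  (- (x * expR (- (x ^+ 2 / 2)))).
Proof.
have dsq : is_derive x 1 (fun y : R => - (y ^+ 2 / 2)) (- x).
  have d2 := @is_deriveX _ _ id 2 x 1 _ (is_derive_id x 1).
  have d3 := @is_deriveZ _ _ _ _ (- 2^-1) _ _ _ d2.
  rewrite (_ : (fun y => _) = (- (2^-1 : R)) *: ((id : R -> R) ^+ 2)).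
    by apply: (is_derive_eq d3); rewrite /GRing.scale/=; field.
  by apply/funext => y /=; rewrite !fctE /GRing.scale/=; field.
have de := is_derive_expR (- (x ^+ 2 / 2)).
have d := @is_derive1_comp _ expR _ x _ _ de dsq.
by apply: (@is_derive_eq _ _ _ _ _ _ _ _ d); ring.
Qed.

(* The difference [K] of the two sides vanishes at [0] and at [+oo], and its
   derivative [(kappa - x) * expR (- (x ^+ 2 / 2))] changes sign once. *)
Lemma abs_normal_tail_le (x : R) : 0 <= x ->
  abs_normal_tail x <= expR (- (x ^+ 2 / 2)).
Proof.
move=> x0; rewrite -subr_ge0.
pose K y := expR (- (y ^+ 2 / 2)) - abs_normal_tail y.
rewrite -[leRHS]/(K x).
have dK (y : R) : is_derive y 1 K ((kappa - y) * expR (- (y ^+ 2 / 2))).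
  have d := is_deriveB (is_derive_gauss y) (is_derive_abs_normal_tail y).
  by apply: (@is_derive_eq _ _ _ _ _ _ _ _ d); ring.
have K' (y : R) : derive1 K y = (kappa - y) * expR (- (y ^+ 2 / 2)).
  by rewrite derive1E; exact: (@derive_val _ _ _ _ _ _ _ (dK y)).
have derK (y : R) : derivable K y 1 by have [] := dK y.
have cK A : {within A, continuous K}.
  apply: continuous_subspaceT => y; apply: differentiable_continuous.
  exact/derivable1_diffP.
have [xk|kx] := leP x kappa.
  have -> : 0 = K 0.
    by rewrite /K abs_normal_tail0 expr0n/= mul0r oppr0 expR0 subrr.
  apply: (@ger0_derive1_ndecr _ K 0 kappa) => // y.
  rewrite in_itv/= => /andP[_ yk].
  by rewrite K' mulr_ge0 ?expR_ge0// subr_ge0 ltW.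
have Kle y : x <= y -> - abs_normal_tail y <= K x.
  move=> xy; apply: (@le_trans _ _ (K y)).
    by rewrite /K -[leLHS]add0r lerD2r expR_ge0.
  apply: (@ler0_derive1_nincry _ K x) => // z.
  rewrite in_itv/= andbT => xz.
  by rewrite K' mulr_le0_ge0 ?expR_ge0// subr_le0 ltW// (lt_trans kx).
rewrite -oppr0; apply: (cvgr_to_le (cvgN cvg_abs_normal_tail)).
by near=> y; apply: Kle; near: y; exact: nbhs_pinfty_ge (num_real x).
Unshelve. all: by end_near. Qed.

(** The hazard rate at [z] is [kappa * expR (- (z ^+ 2 / 2)) / abs_normal_tail z], which is at least
    [kappa] on [z >= 0] by [abs_normal_tail_le]. Hence [L] is non-increasing there. *)
Lemma abs_normal_hazard (x y : R) : 0 <= x -> x <= y ->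
  kappa * (y - x) <= ln (abs_normal_tail x) - ln (abs_normal_tail y).
Proof.
move=> x0 xy.
pose L z := ln (abs_normal_tail z) + kappa * z.
suff : L y <= L x by rewrite /L; lra.
have dL (z : R) : is_derive z 1 L
    (kappa - kappa * expR (- (z ^+ 2 / 2)) / abs_normal_tail z).
  have dl := @is_derive1_comp _ (@ln R) abs_normal_tail z _ _
    (is_derive1_ln (abs_normal_tail_gt0 z)) (is_derive_abs_normal_tail z).
  have d := is_deriveD dl (@is_deriveZ _ _ _ id kappa z 1 _ (is_derive_id z 1)).
  by apply: (is_derive_eq d); rewrite /GRing.scale/=; ring.
have derL (z : R) : derivable L z 1 by have [] := dL z.
apply: (@ler0_derive1_nincry _ L 0) => //.
  move=> z; rewrite in_itv/= andbT => z0.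
  rewrite derive1E (@derive_val _ _ _ _ _ _ _ (dL z)) subr_le0.
  rewrite -mulrA ler_peMr ?(ltW kappa_gt0)//.
  by rewrite ler_pdivlMr ?abs_normal_tail_gt0// mul1r abs_normal_tail_le// ltW.
apply: continuous_subspaceT => z; apply: differentiable_continuous.
exact/derivable1_diffP.
Qed.

End absolute_gaussian_tail.

(** * Exponential moments of exponential order statistics *)

Section exponential_order_statistics.
Context {R : realType}.
Local Notation mu := (@lebesgue_measure R).

Let onem_expRN_ge0 (y : R) : 0 <= y -> 0 <= 1 - expR (- y).
Proof. by move=> y0; rewrite subr_ge0 -expR0 ler_expR oppr_le0. Qed.

Let measurable_expRN (a : R) : measurable_fun setT (fun y => expR (- (a * y))).
Proof.
by apply: measurableT_comp => //; apply: measurableT_comp => //;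
  exact: measurable_funM.
Qed.

(** This is the Beta integral at [(a, m + 1)] after the substitution [u = expR (- y)]. The induction
    on [m] writes 1 as [(1 - expR (- y)) + expR (- y)], which expresses the integral for [m.+1] at
    [a] as the difference of those for [m] at [a] and at [a + 1]. *)
Lemma integral_expR_onemX (m : nat) (a : R) : 0 < a ->
  (\int[mu]_(y in `[0%R, +oo[)
    (expR (- (a * y)) * (1 - expR (- y)) ^+ m)%:E)%E =
  (m`!%:R / \prod_(0 <= i < m.+1) (a + i%:R))%:E.
Proof.
pose f k b (y : R) := expR (- (b * y)) * (1 - expR (- y)) ^+ k.
have f_ge0 k b y : 0 <= y -> 0 <= f k b y.
  by move=> y0; rewrite mulr_ge0 ?expR_ge0// exprn_ge0// onem_expRN_ge0.
have mf k b D : measurable D -> measurable_fun D (EFin \o f k b).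
  move=> mD; apply/measurable_EFinP; apply: measurable_funTS.
  apply: measurable_funM.
    exact: measurable_expRN.
  apply: measurable_funX; apply: measurable_funB => //.
  by apply: measurableT_comp => //; exact: measurableT_comp.
elim: m a => [|m IH] a a0.
  rewrite big_nat1 addr0 fact0 mul1r.
  rewrite -[LHS]/(\int[mu]_(y in `[0%R, +oo[) (f 0%N a y)%:E)%E.
  have aI : (a%:E * \int[mu]_(y in `[0%R, +oo[) (f 0%N a y)%:E = 1)%E.
    rewrite -ge0_integralZl//; last 3 first.
    - exact: mf.
    - by move=> y; rewrite /= in_itv/= andbT => y0; rewrite lee_fin f_ge0.
    - by rewrite lee_fin ltW.
    rewrite -(integral_exponential_pdf a0) integral_mkcond.
    apply: eq_integral => y _.
    rewrite /exponential_pdf -[RHS]/((EFin \o _) y) -restrict_EFin /patch.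
    by case: ifP => //= _; rewrite -EFinM /f expr0 mulr1 mulNr.
  by rewrite -[LHS]mul1e -(@mulVf _ a) ?gt_eqF// EFinM -muleA aI mule1.
rewrite -[LHS]/(\int[mu]_(y in `[0%R, +oo[) (f m.+1 a y)%:E)%E.
have a1 : 0 < a + 1 by rewrite addr_gt0.
have split : (\int[mu]_(y in `[0%R, +oo[) (f m a y)%:E =
    \int[mu]_(y in `[0%R, +oo[) (f m.+1 a y)%:E +
    \int[mu]_(y in `[0%R, +oo[) (f m (a + 1) y)%:E)%E.
  rewrite -ge0_integralD//.
  - apply: eq_integral => y _; rewrite -EFinD; congr EFin.
    by rewrite /f mulrDl opprD expRD mul1r exprS; ring.
  - by move=> y; rewrite /= in_itv/= andbT => y0; rewrite lee_fin f_ge0.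
  - exact: mf.
  - by move=> y; rewrite /= in_itv/= andbT => y0; rewrite lee_fin f_ge0.
  - exact: mf.
move: split; rewrite /f (IH _ a0) (IH _ a1) => split.
rewrite -[LHS](@addeK _ (m`!%:R / \prod_(0 <= i < m.+1) (a + 1 + i%:R))%:E)//.
rewrite -split -EFinB; congr EFin.
rewrite [X in _ / X - _]big_nat_recl//= [X in _ - _ / X]big_nat_recr//=.
rewrite [X in _ = _ / X]big_nat_recl//= [X in _ = _ / (_ * X)]big_nat_recr//=.
rewrite (eq_bigr (fun i => a + 1 + i%:R)) => [|i _]; last first.
  by rewrite -natr1; ring.
have : \prod_(0 <= i < m) (a + 1 + i%:R) != 0.
  by rewrite prodf_seq_neq0; apply/allP => i _ /=; rewrite gt_eqF// ltr_wpDr.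
set Q := \prod_(_ <= _ < _) _ => Q0.
rewrite factS natrM addr0 -natr1.
have am : a + (m%:R + 1) != 0 by rewrite gt_eqF// ltr_wpDr// addr_ge0.
by field; rewrite Q0 am (gt_eqF a0).
Qed.

(* The survival function of the [k]-th largest among [n] independent standard
   exponential variables. *)
Definition exp_order_tail (n k : nat) (y : R) : R :=
  \sum_(k <= j < n.+1)
    expR (- y) ^+ j * (1 - expR (- y)) ^+ (n - j) *+ 'C(n, j).

Lemma exp_order_tail_ge0 n k y : 0 <= y -> 0 <= exp_order_tail n k y.
Proof.
move=> y0; apply: sumr_ge0 => j _.
rewrite mulrn_wge0// mulr_ge0 ?exprn_ge0 ?expR_ge0//.
by rewrite onem_expRN_ge0.
Qed.

Lemma measurable_exp_order_tail n k : measurable_fun setT (exp_order_tail n k).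
Proof.
apply: measurable_sum => j; rewrite /=.
under eq_fun do rewrite -mulr_natr.
apply: measurable_funM => //; apply: measurable_funM => //.
  by apply: measurable_funX; exact: measurableT_comp.
apply: measurable_funX; apply: measurable_funB => //.
exact: measurableT_comp.
Qed.

(** Descending induction on [k]: going from rank [k.+1] to [k] adds one binomial term, whose
    integral is a Beta integral, and multiplies the product by one factor. By
    [expectation_expR_tail], [1 + theta * c] is the moment generating function; this form covers
    [theta = 0] without a division. *)
Lemma integral_exp_order_tail (n k : nat) (theta : R) :
  (k <= n.+1)%N -> theta < k%:R ->
  exists2 c : R,
    (\int[mu]_(y in `[0%R, +oo[)
      (expR (theta * y) * exp_order_tail n k y)%:E)%E = c%:E
    & 1 + theta * c = \prod_(k <= i < n.+1) (i%:R / (i%:R - theta)).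
Proof.
move=> + ; have [m] := ubnP (n.+1 - k); elim: m k => // m IH k nkm.
rewrite leq_eqVlt => /predU1P[->|kn] thk.
  (* At [k = n.+1] both the sum defining the tail and the product are empty. *)
  exists 0; last by rewrite mulr0 addr0 big_geq.
  by apply: integral0_eq => y _; rewrite /exp_order_tail big_geq// mulr0.
have thk1 : theta < k.+1%:R by rewrite (lt_trans thk)// ltr_nat.
have [|c cE cP] := IH k.+1 _ kn thk1.
  by rewrite subnS -ltnS prednK ?subn_gt0.
pose a := k%:R - theta.
have a0 : 0 < a by rewrite subr_gt0.
(* The term [j = k] of the tail, multiplied by [expR (theta * y)]. *)
pose f y := 'C(n, k)%:R * (expR (- (a * y)) * (1 - expR (- y)) ^+ (n - k)).
have f0 y : 0 <= y -> 0 <= f y.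
  move=> y0; rewrite !mulr_ge0 ?expR_ge0//.
  by rewrite exprn_ge0// onem_expRN_ge0.
have mg : measurable_fun setT
    (fun y => expR (- (a * y)) * (1 - expR (- y)) ^+ (n - k)).
  apply: measurable_funM.
    exact: measurable_expRN.
  apply: measurable_funX; apply: measurable_funB => //.
  by apply: measurableT_comp => //; exact: measurableT_comp.
have fE : (\int[mu]_(y in `[0%R, +oo[) (f y)%:E =
    ('C(n, k)%:R *
      ((n - k)`!%:R / \prod_(0 <= i < (n - k).+1) (a + i%:R)))%:E)%E.
  under eq_integral do rewrite /f EFinM.
  rewrite ge0_integralZl//; first by rewrite integral_expR_onemX.
  - by apply/measurable_EFinP; exact: measurable_funTS.
  - move=> y; rewrite /= in_itv/= andbT => y0.
    rewrite lee_fin mulr_ge0 ?expR_ge0//.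
    by rewrite exprn_ge0// onem_expRN_ge0.
have prodE : \prod_(0 <= i < (n - k).+1) (a + i%:R) =
    \prod_(k <= i < n.+1) (i%:R - theta).
  rewrite -{2}[k]add0n big_addn subSn//; apply: eq_bigr => i _.
  by rewrite natrD /a; ring.
have factE : 'C(n, k)%:R * (n - k)`!%:R = \prod_(k.+1 <= i < n.+1) i%:R :> R.
  rewrite -natrM -natr_prod; congr (_%:R); apply/eqP.
  rewrite -(eqn_pmul2l (fact_gt0 k)) mulnCA bin_fact//.
  by rewrite [k`!]fact_prod -big_cat_nat//= -fact_prod.
have P0 : \prod_(k.+1 <= i < n.+1) (i%:R - theta) != 0.
  rewrite gt_eqF// big_nat; apply: prodr_gt0 => i /andP[ki _].
  by rewrite subr_gt0 (lt_trans thk)// ltr_nat.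
exists ('C(n, k)%:R *
  ((n - k)`!%:R / \prod_(0 <= i < (n - k).+1) (a + i%:R)) + c).
  rewrite EFinD -fE -cE -ge0_integralD//.
  - apply: eq_integral => y _; rewrite -EFinD; congr EFin.
    rewrite /f /a /exp_order_tail [in LHS]big_ltn// mulrDr; congr (_ + _).
    rewrite -mulr_natl mulrCA; congr (_ * _); rewrite mulrA; congr (_ * _).
    by rewrite -expRM_natl -expRD; congr expR; ring.
  - by move=> y; rewrite /= in_itv/= andbT => y0; rewrite lee_fin f0.
  - apply/measurable_EFinP; apply: measurable_funTS; exact: measurable_funM.
  - move=> y; rewrite /= in_itv/= andbT => y0.
    by rewrite lee_fin mulr_ge0 ?expR_ge0// exp_order_tail_ge0.
  - apply/measurable_EFinP; apply: measurable_funTS; apply: measurable_funM.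
      by apply: measurableT_comp => //; exact: measurable_funM.
    exact: measurable_exp_order_tail.
rewrite mulrDr addrCA cP prodE mulrA factE.
have -> : \prod_(k <= i < n.+1) (i%:R - theta) =
    (k%:R - theta) * \prod_(k.+1 <= i < n.+1) (i%:R - theta) by rewrite big_ltn.
rewrite [RHS]big_ltn//.
rewrite big_split/= prodfV.
have kth : k%:R - theta != 0 by rewrite subr_eq0 gt_eqF.
by field; rewrite P0.
Qed.

End exponential_order_statistics.

Lemma measurable_bool_set d (T : measurableType d) (b : T -> bool) :
  measurable_fun setT b -> measurable [set x | b x].
Proof. by move=> /(_ measurableT [set true]); rewrite setTI; exact. Qed.

(** * Tail integration, symmetrization and Jensen's inequality *)

Section moment_generating_functions.
Context d (T : measurableType d) (R : realType) (P : probability T R).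
Local Notation mu := (@lebesgue_measure R).
Implicit Types f g : T -> R.

Lemma integral_expR_segment (theta y : R) : theta != 0 -> 0 <= y ->
  (\int[mu]_(x in `[0%R, y[) (expR (theta * x))%:E)%E =
  ((expR (theta * y) - 1) / theta)%:E.
Proof.
move=> th0; rewrite le_eqVlt => /predU1P[<-|y0].
  by rewrite set_itvco0 integral_set0 mulr0 expR0 subrr mul0r.
have c (a : R) : continuous (fun x : R => expR (theta * x) / a).
  move=> x; apply: cvgMl; apply: (cvg_comp (fun x => theta * x) expR).
    by apply: cvgMr; exact: cvg_id.
  exact: continuous_expR.
rewrite integral_itv_bndo_bndc; last first.
  apply/measurable_EFinP; apply: measurable_funTS.
  by apply: measurableT_comp => //; exact: measurable_funM.
rewrite (@continuous_FTC2 _ _ (fun x => expR (theta * x) / theta))//.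
- by rewrite mulr0 expR0 -EFinB mulrBl.
- apply: continuous_subspaceT => x; have := @c 1 x.
  by rewrite /continuous_at; under eq_fun do rewrite divr1; rewrite divr1.
- split => //.
  + by apply: cvg_at_right_filter; exact: c.
  + by apply: cvg_at_left_filter; exact: c.
- move=> x _; rewrite derive1E.
  have d1 := @is_deriveZ _ _ _ (id : R -> R) theta x 1 _ (is_derive_id x 1).
  have d2 := @is_derive1_comp _ expR (theta *: (id : R -> R)) x _ _
    (is_derive_expR _) d1.
  have d3 := @is_deriveZ _ _ _ _ theta^-1 _ _ _ d2.
  rewrite (_ : (fun x => _) = theta^-1 *: (expR \o theta *: (id : R -> R))).
    by rewrite (@derive_val _ _ _ _ _ _ _ d3) /GRing.scale/=; field.
  by apply/funext => z; rewrite !fctE /GRing.scale/= mulrC.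
Qed.

(** Layer cake: [expR (theta * Y)] is 1 plus [theta] times the integral of [expR (theta * y)] over
    [0 <= y < Y], and Tonelli exchanges this integral with the expectation. *)
Lemma expectation_expR_tail (Y : T -> R) (theta c : R) :
  measurable_fun setT Y -> (forall w, 0 <= Y w) ->
  (\int[mu]_(y in `[0%R, +oo[)
    ((expR (theta * y))%:E * P [set w | y < Y w]%R))%E = c%:E ->
  ('E_P[fun w => expR (theta * Y w)] = (1 + theta * c)%:E)%E.
Proof.
move=> mY Y0 Ic; have [->|th0] := eqVneq theta 0.
  under eq_fun do rewrite mul0r expR0.
  by rewrite mul0r addr0 (expectation_cst _ 1).
(* Division by [theta] makes [D] non-negative for either sign of [theta], as Tonelli requires. *)
pose D w := (expR (theta * Y w) - 1) / theta.
pose g (p : T * measurableTypeR R) : R :=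
  expR (theta * p.2) * ((0 <= p.2) && (p.2 < Y p.1))%:R.
have g0 p : 0 <= g p by rewrite mulr_ge0 ?expR_ge0.
have mg : measurable_fun setT g.
  have m2 : measurable_fun setT (fun p : T * measurableTypeR R => p.2 : R).
    exact: measurable_snd.
  apply: measurable_funM.
    apply: measurableT_comp => //; exact: measurable_funM.
  have mb : measurable_fun setT (fun b : bool => b%:R : R) by [].
  apply: (measurableT_comp mb); apply: measurable_and.
    exact: measurable_fun_ler.
  apply: measurable_fun_ltr => //.
  exact: (measurableT_comp mY measurable_fst).
have ED : (\int[P]_w (D w)%:E = c%:E)%E.
  rewrite -Ic; transitivity (\int[P]_w \int[mu]_y (g (w, y))%:E)%E.
    apply: eq_integral => w _; rewrite -integral_expR_segment// integral_mkcond.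
    apply: eq_integral => y _; rewrite /g/= /patch mem_setE in_itv/=.
    by case: ifP => _; rewrite ?mulr1 ?mulr0.
  rewrite (fubini_tonelli (fun p => (g p)%:E)); last 2 first.
  - exact/measurable_EFinP.
  - by move=> p; rewrite lee_fin.
  rewrite [RHS]integral_mkcond; apply: eq_integral => y _.
  rewrite /patch mem_setE in_itv/= andbT /g/=; case: ifPn => y0; last first.
    by apply: integral0_eq => w _ /=; rewrite mulr0.
  have mA : measurable [set w | y < Y w].
    by apply: measurable_bool_set; exact: measurable_fun_ltr.
  rewrite -[in RHS](setIT [set w | y < Y w]) -integral_indic//.
  rewrite -ge0_integralZl//.
  - by apply: eq_integral => w _; rewrite indicE mem_setE -EFinM.
  - exact/measurable_EFinP.
have mD : measurable_fun setT D.
  apply: measurable_funM => //; apply: measurable_funB => //.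
  by apply: measurableT_comp => //; exact: measurable_funM.
have iD : P.-integrable setT (EFin \o D).
  apply/integrableP; split; first exact/measurable_EFinP.
  under eq_integral => w _.
    rewrite /= ger0_norm; first over.
    have [th|th] := ltrP 0 theta.
      by rewrite divr_ge0 ?(ltW th)// subr_ge0 -expR0 ler_expR mulr_ge0// ltW.
    rewrite /D -mulrNN mulr_ge0 ?oppr_ge0 ?invr_le0//.
    by rewrite subr_le0 -expR0 ler_expR mulr_le0_ge0.
  by rewrite ED ltry.
rewrite unlock.
transitivity (\int[P]_w (cst 1%:E w + theta%:E * (D w)%:E))%E.
  apply: eq_integral => w _; rewrite /= -EFinM -EFinD; congr EFin.
  by rewrite /D; field.
rewrite integralD//; last 2 first.
- exact: finite_measure_integrable_cst.
- exact: integrableZl.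
by rewrite integralZl// ED integral_cst//= probability_setT mule1 -EFinM.
Qed.

(** By evenness [a] and [b] may be replaced by their moduli; the difference of the two sides then
    factors as [(expR b - expR a) * (1 - expR (- (a + b)))], with both factors non-negative. *)
Lemma ler_coshR (a b : R) : `|a| <= `|b| ->
  expR a + expR (- a) <= expR b + expR (- b).
Proof.
have absE (x : R) : expR x + expR (- x) = expR `|x| + expR (- `|x|).
  by case: (ger0P x) => // _; rewrite opprK addrC.
rewrite absE (absE b); move: `|a| `|b| (normr_ge0 a) => {}a {}b a0 ab.
rewrite -subr_ge0.
have -> : expR b + expR (- b) - (expR a + expR (- a)) =
    (expR b - expR a) * (1 - expR (- (a + b))).
  have -> : expR (- b) = expR a * expR (- (a + b)).
    by rewrite -expRD; congr expR; ring.
  have -> : expR (- a) = expR b * expR (- (a + b)).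
    by rewrite -expRD; congr expR; ring.
  by ring.
rewrite mulr_ge0// subr_ge0 ?ler_expR// -expR0 ler_expR oppr_le0.
by rewrite addr_ge0// (le_trans a0).
Qed.

Local Open Scope ereal_scope.

Let measurable_expR_comp f : measurable_fun setT f ->
  measurable_fun setT (fun w => (expR (f w))%:E).
Proof. by move=> mf; apply/measurable_EFinP; exact: measurableT_comp. Qed.

(** Each of the two exponentials splits into a function of [w] times one of [w'] and integrates to
    the same product, whence the factor 2. All integrands are non-negative, so infinite values are
    allowed. *)
Let mgf_prodE f : measurable_fun setT f ->
  \int[P]_w \int[P]_w' (expR (f w - f w') + expR (- (f w - f w')))%:E =
  2%:E * ('E_P[fun w => expR (f w)] * 'E_P[fun w => expR (- f w)]).
Proof.
move=> mf; rewrite unlock.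
have mNf : measurable_fun setT (fun w => - f w)%R by exact: measurableT_comp.
have mef := measurable_expR_comp mf; have meNf := measurable_expR_comp mNf.
set A := \int[P]_w (expR (f w))%:E; set B := \int[P]_w (expR (- f w))%:E.
have A0 : 0 <= A by apply: integral_ge0 => w _; rewrite lee_fin expR_ge0.
have B0 : 0 <= B by apply: integral_ge0 => w _; rewrite lee_fin expR_ge0.
transitivity (\int[P]_w ((expR (f w))%:E * B + (expR (- f w))%:E * A)).
  apply: eq_integral => w _.
  transitivity (\int[P]_w' ((expR (f w))%:E * (expR (- f w'))%:E +
      (expR (- f w))%:E * (expR (f w'))%:E)).
    apply: eq_integral => w' _.
    by rewrite -!EFinM -!expRD -EFinD opprB [(f w' - f w)%R]addrC.
  rewrite ge0_integralD//.
  - by rewrite !ge0_integralZl ?lee_fin ?expR_ge0.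
  - exact: emeasurable_funM.
  - exact: emeasurable_funM.
rewrite ge0_integralD//; last 4 first.
- by move=> w _; rewrite mule_ge0 ?lee_fin ?expR_ge0.
- exact: emeasurable_funM.
- by move=> w _; rewrite mule_ge0 ?lee_fin ?expR_ge0.
- exact: emeasurable_funM.
rewrite !ge0_integralZr//.
by rewrite -/A -/B [B * A]muleC mule_natl mule2n.
Qed.

(* Both products are integrals over [P \x P] of [2 * cosh] of a difference of
   two independent copies. *)
Lemma mgf_prod_le f g : measurable_fun setT f -> measurable_fun setT g ->
  (forall w w', `|f w - f w'| <= `|g w - g w'|)%R ->
  'E_P[fun w => expR (f w)] * 'E_P[fun w => expR (- f w)] <=
  'E_P[fun w => expR (g w)] * 'E_P[fun w => expR (- g w)].
Proof.
move=> mf mg fg.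
set a := 'E_P[_] * _; set b := 'E_P[_] * _.
suff : 2%:E * a <= 2%:E * b by rewrite lee_pmul2l// lte_fin.
rewrite /a /b -(mgf_prodE mf) -(mgf_prodE mg).
have m2 (h : T -> R) : measurable_fun setT h -> measurable_fun setT
    (fun p : T * T => (expR (h p.1 - h p.2) + expR (- (h p.1 - h p.2)))%:E).
  move=> mh; apply/measurable_EFinP.
  have mB : measurable_fun setT (fun p : T * T => h p.1 - h p.2)%R.
    apply: measurable_funB; first exact: measurableT_comp measurable_fst.
    exact: measurableT_comp measurable_snd.
  apply: measurable_funD; first exact: measurableT_comp.
  by apply: measurableT_comp => //; exact: measurableT_comp.
have cosh0 (h : T -> R) (p : T * T) :
    0 <= (expR (h p.1 - h p.2) + expR (- (h p.1 - h p.2)))%:E.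
  by rewrite lee_fin addr_ge0 ?expR_ge0.
apply: ge0_le_integral => //.
- by move=> w _; apply: integral_ge0 => w' _; exact: (cosh0 f (w, w')).
- exact: (@measurable_fun_fubini_tonelli_F _ _ T T R P _ (m2 f mf) (cosh0 f)).
- exact: (@measurable_fun_fubini_tonelli_F _ _ T T R P _ (m2 g mg) (cosh0 g)).
move=> w _; apply: ge0_le_integral => //.
- exact: (measurableT_comp (m2 f mf) (pair1_measurable _)).
- exact: (measurableT_comp (m2 g mg) (pair1_measurable _)).
by move=> w' _; rewrite lee_fin ler_coshR.
Qed.

(** Jensen's inequality for the exponential, by integrating its tangent line at the mean [m]:
    [expR m * (1 - m + f w) <= expR (f w)]. *)
Lemma expR_expectation_le f : P.-integrable setT (EFin \o f) ->
  (expR (fine 'E_P[f]))%:E <= 'E_P[fun w => expR (f w)].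
Proof.
move=> fi.
have mf : measurable_fun setT f by case/integrableP : fi => /measurable_EFinP.
have mef := measurable_expR_comp mf.
have [efi|] := ltP 'E_P[fun w => expR (f w)] +oo; last first.
  by rewrite leye_eq => /eqP ->; rewrite leey.
pose m := fine 'E_P[f].
have fE : 'E_P[f] = m%:E.
  by rewrite fineK// unlock integrable_fin_num.
have fmi : P.-integrable setT
    (fun w => (expR m)%:E * (cst (1 - m)%:E w + (f w)%:E)).
  apply: integrableZl => //; apply: integrableD => //.
  exact: finite_measure_integrable_cst.
have <- : \int[P]_w ((expR m)%:E * (cst (1 - m)%:E w + (f w)%:E)) = (expR m)%:E.
  rewrite integralZl//; last first.
    by apply: integrableD => //; exact: finite_measure_integrable_cst.
  rewrite integralD//; last exact: finite_measure_integrable_cst.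
  rewrite integral_cst//= probability_setT mule1.
  move: fE; rewrite unlock => ->; rewrite -EFinD subrK mule1//.
rewrite unlock; apply: le_integral => //.
  apply/integrableP; split => //.
  under eq_integral do rewrite /= ger0_norm ?expR_ge0//.
  by move: efi; rewrite unlock.
move=> w _; rewrite -EFinD -EFinM lee_fin.
rewrite -{2}(subrK m (f w)) expRD mulrC ler_pM2r ?expR_gt0//.
by apply: le_trans (expR_ge1Dx _); lra.
Qed.

(** Centering contributes the factor [expR (- (lambda * m))], the exponential of the mean of
    [- (lambda * f)], and Jensen's inequality bounds it by the second expectation. *)
Lemma centered_mgf_le f (lambda : R) : P.-integrable setT (EFin \o f) ->
  'E_P[fun w => expR (lambda * (f w - fine 'E_P[f]))] <=
  'E_P[fun w => expR (lambda * f w)] * 'E_P[fun w => expR (- (lambda * f w))].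
Proof.
move=> fi.
have mf : measurable_fun setT f by case/integrableP : fi => /measurable_EFinP.
pose m := fine 'E_P[f].
have -> : 'E_P[fun w => expR (lambda * (f w - m))] =
    'E_P[fun w => expR (lambda * f w)] * (expR (- (lambda * m)))%:E.
  rewrite unlock -ge0_integralZr ?lee_fin ?expR_ge0//.
  - by apply: eq_integral => w _; rewrite -EFinM -expRD mulrBr.
  - by apply: measurable_expR_comp; exact: measurable_funM.
rewrite lee_wpmul2l ?expectation_ge0//.
have ZE w : (- (lambda * f w))%:E = (- lambda)%:E * (f w)%:E.
  by rewrite -EFinM mulNr.
have iZ : P.-integrable setT (fun w => (- (lambda * f w))%:E).
  by apply: eq_integrable (integrableZl _ _ fi) => // w _; rewrite ZE.
have -> : (- (lambda * m) = fine 'E_P[fun w => - (lambda * f w)])%R.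
  rewrite /m unlock (eq_integral _ _ (fun w _ => ZE w)).
  by rewrite integralZl// fineM ?integrable_fin_num//= mulNr.
exact: expR_expectation_le.
Qed.

End moment_generating_functions.

(** * Numerical estimates for the product *)

Section numeric_bounds.
Context {R : realType}.
Implicit Types (theta lambda : R).

(** Because [expR 5^-1 >= 6 / 5] and [(6 / 5) ^+ 4 = 1296 / 625 > 2]. The value is chosen to cancel
    the 5/4 of [sum_sqrV_le]. *)
Lemma ln2_le : ln 2 <= 4 / 5 :> R.
Proof.
rewrite -(expRK (4 / 5)) ler_ln ?posrE ?expR_gt0//.
have -> : 4 / 5 = 5^-1 * 4%:R :> R by rewrite mulrC.
rewrite expRM_natr.
have : 6 / 5 <= expR 5^-1 :> R by apply: le_trans (expR_ge1Dx _); lra.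
move=> h; have : (6 / 5 : R) ^+ 4 <= expR 5^-1 ^+ 4.
  by rewrite lerXn2r// nnegrE ?expR_ge0//; lra.
by apply: le_trans; rewrite !exprS expr0; lra.
Qed.

(** The first term is kept and the others telescope, which leaves [1 / k^2 + 1 / (2 k)]; this
    suffices for [k >= 2]. For [k = 1] there is equality, [1 + 1/4 = 5/4], checked separately. *)
Lemma sum_sqrV_le (k : nat) : (0 < k)%N ->
  \sum_(k <= i < k.*2.+1) (i%:R ^- 2 : R) <= 5 / (4 * k%:R).
Proof.
have tele m : (0 < k <= m)%N ->
    \sum_(k.+1 <= i < m.+1) (i%:R ^- 2 : R) <= k%:R^-1 - m%:R^-1.
  move=> /andP[k0]; elim: m => [|m IH].
    by rewrite leqn0 => /eqP k0'; rewrite k0' in k0.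
  rewrite leq_eqVlt => /predU1P[->|]; first by rewrite big_geq// subrr.
  rewrite ltnS => km.
  rewrite big_nat_recr//= (le_trans (lerD (IH km) (lexx _)))//.
  have m0 : 0 < m%:R :> R by rewrite ltr0n (leq_trans k0).
  rewrite -subr_ge0 -natr1.
  have -> : k%:R^-1 - (m%:R + 1)^-1 - (k%:R^-1 - m%:R^-1 + (m%:R + 1) ^- 2) =
     (m%:R * (m%:R + 1) ^+ 2)^-1 :> R.
    by field; rewrite !gt_eqF ?addr_gt0// ltr0n.
  by rewrite invr_ge0 mulr_ge0 ?exprn_ge0 ?addr_ge0 ?ltW.
move=> k0; have [->|k1] := eqVneq k 1%N.
  rewrite big_ltn// big_nat1 expr1n; lra.
have k2 : 2 <= k%:R :> R by rewrite ler_nat; case: k k0 k1 {tele} => [|[]].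
have kk : (k <= k.*2)%N by rewrite -addnn leq_addr.
rewrite big_ltn ?ltnS//.
apply: (le_trans (lerD (lexx _) (tele k.*2 _))); first by rewrite k0.
rewrite -subr_ge0 -muln2 natrM.
have -> : 5 / (4 * k%:R) - (k%:R ^- 2 + (k%:R^-1 - (k%:R * 2)^-1)) =
    (3 * k%:R - 4) / (4 * k%:R ^+ 2) :> R.
  by field; rewrite gt_eqF// ltr0n.
by rewrite divr_ge0 ?mulr_ge0 ?exprn_ge0//; lra.
Qed.

(** The factors at [theta] and [- theta] combine into [1 + theta^2 / (i^2 - theta^2)]. Then
    [1 + x <= expR x], and [i^2 - theta^2 >= i^2 (1 - theta^2 / k^2)] for [i >= k] reduces the
    exponent to [sum_sqrV_le]. *)
Lemma prod_order_mgf_le (k : nat) theta : (0 < k)%N -> `|theta| < k%:R ->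
  (\prod_(k <= i < k.*2.+1) (i%:R / (i%:R - theta))) *
  (\prod_(k <= i < k.*2.+1) (i%:R / (i%:R + theta))) <=
  expR (theta ^+ 2 / (1 - theta ^+ 2 / k%:R ^+ 2) * (5 / (4 * k%:R))).
Proof.
move=> k0 thk; rewrite -big_split/=.
have k0R : 0 < k%:R :> R by rewrite ltr0n.
have thk2 : theta ^+ 2 < k%:R ^+ 2.
  by rewrite -(real_normK (num_real theta)) ltr_pXn2r// ?nnegrE ?ltW.
have z1 : 0 < 1 - theta ^+ 2 / k%:R ^+ 2.
  by rewrite subr_gt0 ltr_pdivrMr ?exprn_gt0// mul1r.
set q := theta ^+ 2 / _.
apply: (@le_trans _ _ (\prod_(k <= i < k.*2.+1) expR (q * i%:R ^- 2))).
  rewrite !big_nat; apply: ler_prod => i /andP[ki _].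
  have kiR : k%:R <= i%:R :> R by rewrite ler_nat.
  have i0 : 0 < i%:R :> R by apply: lt_le_trans kiR.
  have i2 : k%:R ^+ 2 <= i%:R ^+ 2 :> R by rewrite lerXn2r// nnegrE ltW.
  have D0 : 0 < i%:R ^+ 2 - theta ^+ 2 by rewrite subr_gt0 (lt_le_trans thk2).
  have -> : i%:R / (i%:R - theta) * (i%:R / (i%:R + theta)) =
      1 + theta ^+ 2 / (i%:R ^+ 2 - theta ^+ 2).
    have := gt_eqF D0; rewrite subr_sqr => /negbT.
    rewrite mulf_eq0 negb_or => /andP[h1 h2].
    by field; rewrite h1 h2.
  apply/andP; split; first by rewrite addr_ge0// divr_ge0 ?sqr_ge0 ?ltW.
  apply: le_trans (expR_ge1Dx _) _; rewrite ler_expR /q -[leRHS]mulrA.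
  apply: ler_wpM2l; first exact: sqr_ge0.
  rewrite -invfM lef_pV2 ?posrE ?mulr_gt0 ?exprn_gt0//.
  rewrite mulrBl mul1r lerD2l lerN2 mulrAC -mulrA ler_peMr ?sqr_ge0//.
  by rewrite ler_pdivlMr ?exprn_gt0// mul1r.
rewrite -expR_sum ler_expR -mulr_sumr ler_wpM2l ?sum_sqrV_le//.
by rewrite divr_ge0 ?sqr_ge0 ?ltW.
Qed.

(** With [x = 2 * lambda * sqrt (v / n)], the denominators compare through
    [theta^2 / k^2 <= x^2 <= x], the last step because [0 <= x < 1]. The numerators compare through
    [5 / 4 * ln 2 <= 1]. *)
Lemma order_mgf_exponent_le (k : nat) lambda theta : (0 < k)%N -> 0 <= lambda ->
  theta ^+ 2 <= 2 * lambda ^+ 2 ->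
  2 * lambda * Num.sqrt (vn R k.*2 / k.*2%:R) < 1 ->
  `|theta| < k%:R /\
  theta ^+ 2 / (1 - theta ^+ 2 / k%:R ^+ 2) * (5 / (4 * k%:R)) <=
  vn R k.*2 * lambda ^+ 2 /
    (2 * (1 - 2 * lambda * Num.sqrt (vn R k.*2 / k.*2%:R))).
Proof.
move=> k0 l0 thl; have k0R : 0 < k%:R :> R by rewrite ltr0n.
have ln2 := ln2_le; have ln2_0 : 0 < ln 2 :> R by rewrite ln_gt0// ltr1n.
have vE : vn R k.*2 / k.*2%:R = 2 / (k%:R ^+ 2 * ln 2).
  by rewrite /vn -muln2 natrM; field; rewrite !gt_eqF.
have vE' : vn R k.*2 = 4 / (k%:R * ln 2).
  by rewrite /vn -muln2 natrM; field; rewrite !gt_eqF.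
rewrite vE vE'; set s := Num.sqrt _; set x := 2 * lambda * s => x1.
have s2 : s ^+ 2 = 2 / (k%:R ^+ 2 * ln 2).
  by rewrite sqr_sqrtr// divr_ge0// mulr_ge0 ?sqr_ge0 ?ltW.
have x0 : 0 <= x by rewrite !mulr_ge0// sqrtr_ge0.
have thx : theta ^+ 2 / k%:R ^+ 2 <= x.
  apply: (@le_trans _ _ (x ^+ 2)); last by rewrite expr2 ler_piMr// ltW.
  rewrite /x !exprMn s2 ler_pdivrMr ?exprn_gt0//.
  have -> : 2 ^+ 2 * lambda ^+ 2 * (2 / (k%:R ^+ 2 * ln 2)) * k%:R ^+ 2 =
      8 * lambda ^+ 2 / ln 2 :> R by field; rewrite !gt_eqF.
  apply: (le_trans thl); rewrite ler_pdivlMr//.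
  have := sqr_ge0 lambda; nra.
split.
  rewrite -(@ltr_pXn2r _ 2)// ?nnegrE ?ltW// (real_normK (num_real theta)).
  by rewrite -[ltRHS]mul1r -ltr_pdivrMr ?exprn_gt0// (le_lt_trans thx).
have y0 : 0 < 1 - x by rewrite subr_gt0.
have -> : 4 / (k%:R * ln 2) * lambda ^+ 2 / (2 * (1 - x)) =
    (2 * lambda ^+ 2 / (k%:R * ln 2)) / (1 - x) by field; rewrite !gt_eqF.
rewrite mulrAC ler_pM//.
- by rewrite mulr_ge0 ?sqr_ge0// divr_ge0// mulr_ge0// ltW.
- by rewrite invr_ge0 subr_ge0 (le_trans thx)// ltW.
- rewrite ler_pdivlMr ?mulr_gt0//.
  have -> : theta ^+ 2 * (5 / (4 * k%:R)) * (k%:R * ln 2) =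
      theta ^+ 2 * (5 / 4 * ln 2).
    by field; rewrite !gt_eqF.
  have := sqr_ge0 theta; nra.
- by rewrite lef_pV2 ?posrE ?lerD2l ?lerN2// (lt_le_trans y0)// lerD2l lerN2.
Qed.

End numeric_bounds.

(** * From a sub-gamma moment bound to a tail bound *)

Lemma sub_gamma_tail d (T : measurableType d) (R : realType)
    (P : probability T R) (Z : {RV P >-> R}) (v c : R) : 0 < v -> 0 < c ->
  (forall lambda : R, 0 <= lambda -> c * lambda < 1 ->
    (lne 'E_P[fun w => expR (lambda * Z w)] <=
      (v * lambda ^+ 2 / (2 * (1 - c * lambda)))%:E)%E) ->
  forall t : R, 0 < t ->
    (P [set w | Z w > Num.sqrt (2 * v * t) + c * t]%R <= (expR (- t))%:E)%E.
Proof.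
move=> v0 c0 mgf t t0.
pose r := Num.sqrt (2 * t / v).
have r0 : 0 < r by rewrite sqrtr_gt0 divr_gt0 ?mulr_gt0.
have r2 : v * r ^+ 2 = 2 * t.
  by rewrite sqr_sqrtr ?divr_ge0 ?mulr_ge0 ?ltW//; field; rewrite gt_eqF.
have sE : Num.sqrt (2 * v * t) = v * r.
  have -> : 2 * v * t = (v * r) ^+ 2.
    by rewrite (_ : (v * r) ^+ 2 = v * (v * r ^+ 2)); [rewrite r2; ring|ring].
  by rewrite sqrtr_sqr ger0_norm// mulr_ge0 ?ltW.
pose q := 1 + c * r.
have q0 : 0 < q by rewrite addr_gt0 ?mulr_gt0.
(* With this choice [1 - c * lambda = q^-1], the moment bound is [t / q], and
   [lambda * s = (2 t + c r t) / q], so the Chernoff exponent is exactly [- t]. *)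
pose lambda := r / q.
have l0 : 0 < lambda by rewrite divr_gt0.
have cl : 1 - c * lambda = q^-1 by rewrite /lambda /q; field; rewrite gt_eqF.
have cl1 : c * lambda < 1 by rewrite -subr_gt0 cl invr_gt0.
have := mgf lambda (ltW l0) cl1; rewrite cl.
set M := 'E_P[_]%E => Mle.
have M0 : (0 <= M)%E by apply: expectation_ge0 => w; exact: expR_ge0.
have {}Mle : (M <= (expR (t / q))%:E)%E.
  rewrite -[M]lneK; last by rewrite in_itv/= M0 leey.
  rewrite -[leRHS]/(expeR (t / q)%:E) lee_expeR (le_trans Mle)// lee_fin.
  have -> : v * lambda ^+ 2 / (2 / q) = v * r ^+ 2 / (2 * q).
    by rewrite /lambda; field; rewrite gt_eqF.
  by rewrite r2 -mulf_div divff ?mul1r// pnatr_eq0.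
set s := _ + c * t.
(* [chernoff] bounds the event with the large inequality. *)
apply: (@le_trans _ _ (P [set w | s <= Z w])).
  apply: le_measure; rewrite ?inE.
  - by apply: measurable_bool_set; apply: measurable_fun_ltr.
  - by apply: measurable_bool_set; apply: measurable_fun_ler.
  - by move=> w /= /ltW.
apply: le_trans (chernoff Z s l0) _.
have -> : ('M_P Z lambda = M)%E.
  rewrite /mmt_gen_fun /M; congr ('E_P[_])%E.
  by apply/funext => w /=; rewrite mulrC.
apply: (@le_trans _ _ ((expR (t / q))%:E * (expR (- (lambda * s)))%:E)%E).
  by rewrite lee_wpmul2r// lee_fin expR_ge0.
rewrite -EFinM -expRD lee_fin ler_expR /s sE /lambda.
have -> : r / q * (v * r + c * t) = (v * r ^+ 2 + c * r * t) / q.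
  by field; rewrite gt_eqF.
rewrite r2 le_eqVlt; apply/orP; left; apply/eqP.
by rewrite /q; field; rewrite gt_eqF.
Qed.

(** * Law of the median and its exponential transform *)

Lemma measurable_abs_median d (T : measurableType d) (R : realType)
    (P : probability T R) (n : nat) (G : 'I_n -> {RV P >-> R}) :
  (1 < n)%N -> measurable_fun setT (abs_median G).
Proof.
move=> n1; apply: (@measurability _ _ _ _ _ _ _ (RGenOInfty.measurableE R)).
(* Open rays []s, +oo[] generate the Borel sets, and the preimage of each is a counting event. *)
move=> _ [_ [s ->] <-]; rewrite setTI.
pose A : set R := [set z | s < `|z|].
have mA : measurable A.
  by apply: measurable_bool_set; exact: measurable_fun_ltr.
have medianE w :
    (s < abs_median G w) = (n./2 <= #|[set i | G i w \in A]%SET|)%N.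
  rewrite (@order_stat_pred _ (fun z => s < z)) => [|a b ab sa|]; last 2 first.
  - exact: lt_le_trans ab.
  - rewrite half_gt0 n1 -[X in (_ <= X)%N]odd_double_half.
    by rewrite -addnn addnA leq_addl.
  congr (_ <= _)%N; apply: eq_card => i; rewrite !inE /A.
  by apply/idP/idP => [sG|]; [rewrite inE|rewrite inE].
rewrite (_ : _ @^-1` _ = [set w | (n./2 <= #|[set i | G i w \in A]%SET|)%N]).
  exact: measurable_count_ge.
by apply/seteqP; split => w /=; rewrite in_itv/= andbT medianE.
Qed.

Lemma measurable_abs_normal_tail_lt (R : realType) (u : R) :
  measurable [set z : R | abs_normal_tail `|z| < u].
Proof.
apply: measurable_bool_set; apply: measurable_fun_ltr => //.
apply: measurableT_comp => //; apply: continuous_measurable_fun.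
exact: continuous_abs_normal_tail.
Qed.

(** Probability integral transform: the tail is strictly decreasing and, by the intermediate value
    theorem between 0 and a far point [m], equals [u] at some [s >= 0]; the event is then that the
    modulus exceeds [s]. *)
Lemma standard_gaussian_tail_lt d (T : measurableType d) (R : realType)
    (P : probability T R) (G : {RV P >-> R}) (u : R) : standard_gaussian G ->
  0 < u <= 1 -> P (G @^-1` [set z : R | abs_normal_tail `|z| < u]) = u%:E.
Proof.
move=> G_gauss /andP[u0 u1].
have [s s0 Js] : exists2 s, 0 <= s & abs_normal_tail s = u.
  have /cvgrPdist_lt/(_ _ u0) [M [_ MJ]] := @cvg_abs_normal_tail R.
  pose m := Num.max 0 M + 1.
  have m0 : 0 <= m by rewrite addr_ge0 // le_max lexx.
  have Jm : abs_normal_tail m < u.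
    have := MJ m; rewrite /= sub0r normrN.
    rewrite ger0_norm ?ltW ?abs_normal_tail_gt0//; apply.
    by rewrite (@le_lt_trans _ _ (Num.max 0 M)) ?le_max ?lexx ?orbT// ltrDl.
  have [|s] := @IVT R abs_normal_tail 0 m u m0
    (continuous_subspaceT (@continuous_abs_normal_tail R)).
    by rewrite abs_normal_tail0 ge_min le_max u1 (ltW Jm) orbT.
  by rewrite in_itv/= => /andP[s0 _] Js; exists s.
have -> : [set z : R | abs_normal_tail `|z| < u] = [set z : R | s < `|z|].
  apply/seteqP; split=> z /=; rewrite -Js; last exact: abs_normal_tail_decr.
  apply: contraTT; rewrite -!leNgt le_eqVlt.
  by move=> /predU1P[->//|/abs_normal_tail_decr/ltW].
have mA : measurable [set z : R | s < `|z|].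
  by apply: measurable_bool_set; exact: measurable_fun_ltr.
by rewrite -[LHS]/(distribution P G _) G_gauss// -Js abs_normal_tailE.
Qed.

Section abs_gaussian_median.
Context d (T : measurableType d) (R : realType) (P : probability T R).
Context (k : nat) (G : 'I_k.*2 -> {RV P >-> R}).
Hypotheses (k_gt0 : (0 < k)%N) (G_indep : mutually_independent G).
Hypothesis G_gauss : forall i, standard_gaussian (G i).

Local Notation X := (abs_median G).
Local Notation J := (@abs_normal_tail R).
Let Y w := - ln (J (X w)).

Let median_pred (p : pred R) w : (forall a b, a <= b -> p a -> p b) ->
  p (X w) = (k <= #|[set i | p `|G i w|%R]%SET|)%N.
Proof.
move=> up; rewrite /abs_median doubleK order_stat_pred//.
by rewrite k_gt0 -addnn leq_addr.
Qed.

Let mX : measurable_fun setT X.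
Proof. by apply: measurable_abs_median; rewrite -[2%N]/(1.*2) leq_double. Qed.

Let X_ge0 w : 0 <= X w.
Proof.
rewrite (@median_pred (fun x => 0 <= x)) => [|a b ab a0]; last first.
  exact: le_trans ab.
rewrite (eq_card (B := [set: 'I_k.*2]%SET)) => [|i]; last first.
  by rewrite !inE normr_ge0.
by rewrite cardsT card_ord -addnn leq_addr.
Qed.

Let mY : measurable_fun setT Y.
Proof.
apply: measurableT_comp => //; apply: measurableT_comp => //.
apply: measurableT_comp => //; apply: continuous_measurable_fun.
exact: continuous_abs_normal_tail.
Qed.

Let Y_ge0 w : 0 <= Y w.
Proof.
rewrite oppr_ge0 ln_le0// -(@abs_normal_tail0 R).
by have := X_ge0 w; rewrite le_eqVlt => /predU1P[<-//|/abs_normal_tail_decr/ltW].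
Qed.

(** Since [J] decreases, [J z < expR (- y)] is up-closed in [z], so [y < Y w] says that at least [k]
    coordinates satisfy it; each does so with probability [expR (- y)]. *)
Let Y_tail (y : R) : 0 <= y ->
  P [set w | y < Y w] = (exp_order_tail k.*2 k y)%:E.
Proof.
move=> y0; have u01 : 0 < expR (- y) <= 1.
  by rewrite expR_gt0 -expR0 ler_expR oppr_le0.
pose A : set R := [set z | J `|z| < expR (- y)].
have mA : measurable A by exact: measurable_abs_normal_tail_lt.
have PA i := standard_gaussian_tail_lt (G_gauss i) u01.
rewrite -(probability_count_ge mA _ G_indep PA).
congr (P _); apply/seteqP.
have JX w : (y < Y w) = (k <= #|[set i | G i w \in A]%SET|)%N.
  rewrite /Y ltrNr -ltr_expR lnK ?posrE ?abs_normal_tail_gt0//.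
  rewrite (@median_pred (fun z => J z < expR (- y))) => [|a b]; last first.
    by rewrite le_eqVlt => /predU1P[->//|/abs_normal_tail_decr]; exact: lt_trans.
  by congr (_ <= _)%N; apply: eq_card => i; rewrite !inE /A mem_setE.
by split=> w /=; rewrite JX.
Qed.

Let Y_mgf (theta : R) : theta < k%:R ->
  ('E_P[fun w => expR (theta * Y w)] =
    (\prod_(k <= i < k.*2.+1) (i%:R / (i%:R - theta)))%:E)%E.
Proof.
move=> thk; have kk : (k <= k.*2.+1)%N by rewrite leqW// -addnn leq_addr.
have [c cE <-] := integral_exp_order_tail kk thk.
apply: expectation_expR_tail => //; rewrite -cE; apply: eq_integral => y.
by rewrite inE/= in_itv/= andbT => y0; rewrite Y_tail.
Qed.

Let kappa : R := 2 * normal_peak 1.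

Let kappa_gt0 : 0 < kappa.
Proof. by rewrite mulr_gt0// normal_peak_gt0. Qed.

Let X_lipschitz w w' : kappa * `|X w - X w'| <= `|Y w - Y w'|.
Proof.
wlog ww' : w w' / X w' <= X w.
  move=> H; have /orP[] := le_total (X w') (X w); first exact: H.
  by move=> /H; rewrite distrC [X in _ -> _ <= X]distrC.
rewrite ger0_norm ?subr_ge0//; apply: le_trans (ler_norm _).
by have := abs_normal_hazard (X_ge0 w') ww'; rewrite /Y -/kappa; lra.
Qed.

(** The hazard bound from 0 gives [kappa * X <= Y <= 2 * expR (Y / 2)], and the exponential moment
    of [Y] at [1/2] is finite because [1/2 < k]. *)
Let integrable_X : P.-integrable setT (EFin \o X).
Proof.
have half_lt : 2^-1 < k%:R :> R.
  by rewrite (@lt_le_trans _ _ 1)// ?invf_lt1 ?ltr1n// ler1n.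
have XY w : X w <= 2 / kappa * expR (2^-1 * Y w).
  have := abs_normal_hazard (lexx 0) (X_ge0 w).
  rewrite abs_normal_tail0 ln1 sub0r subr0 -/(Y w) -/kappa => XY.
  have := expR_ge1Dx (2^-1 * Y w) => YE.
  rewrite mulrAC ler_pdivlMr// mulrC; lra.
apply/integrableP; split; first exact/measurable_EFinP.
under eq_integral do rewrite /= ger0_norm//.
apply: (@le_lt_trans _ _
  (\int[P]_w ((2 / kappa)%:E * (expR (2^-1 * Y w))%:E))%E).
  apply: ge0_le_integral => //.
  - by move=> w _; rewrite lee_fin.
  - exact/measurable_EFinP.
  - apply/measurable_EFinP; apply: measurable_funM => //.
    by apply: measurableT_comp => //; exact: measurable_funM.
  - by move=> w _; rewrite -EFinM lee_fin XY.
rewrite ge0_integralZl//; last 2 first.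
- apply/measurable_EFinP; apply: measurableT_comp => //; exact: measurable_funM.
- by rewrite lee_fin divr_ge0// ltW.
have := Y_mgf half_lt; rewrite unlock => ->.
by rewrite -EFinM ltry.
Qed.

Lemma abs_median_mgf_le (lambda : R) : 0 <= lambda ->
  2 * lambda * Num.sqrt (vn R k.*2 / k.*2%:R) < 1 ->
  (lne 'E_P[fun w => expR (lambda * (X w - fine 'E_P[X]))] <=
   (vn R k.*2 * lambda ^+ 2 /
     (2 * (1 - 2 * lambda * Num.sqrt (vn R k.*2 / k.*2%:R))))%:E)%E.
Proof.
(* By [X_lipschitz], increments of [lambda * X] are dominated by those of [theta * Y]. *)
move=> l0 l1; pose theta := lambda / kappa.
(* Here [theta^2 = lambda^2 * pi / 2], and [pi / 2 < 2]. *)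
have th2 : theta ^+ 2 <= 2 * lambda ^+ 2.
  rewrite /theta expr_div_n mulrC; apply: ler_wpM2r; first exact: sqr_ge0.
  rewrite /kappa exprMn /normal_peak expr1n mul1r exprVn sqr_sqrtr; last first.
    by rewrite mulrn_wge0// pi_ge0.
  rewrite invfM invrK; have := @pihalf_lt2 R; rewrite -mulr_natl; lra.
have [thk Ble] := order_mgf_exponent_le k_gt0 l0 th2 l1.
have /andP[thNk thk'] : - k%:R < theta < k%:R by rewrite -ltr_norml.
set M := 'E_P[_]%E; set B := _ / (2 * _) in Ble *.
have M0 : (0 <= M)%E by apply: expectation_ge0 => w; exact: expR_ge0.
have MB : (M <= (expR B)%:E)%E.
  apply: (le_trans (centered_mgf_le lambda integrable_X)).
  have mlX : measurable_fun setT (fun w => lambda * X w).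
    exact: measurable_funM.
  have mtY : measurable_fun setT (fun w => theta * Y w).
    exact: measurable_funM.
  apply: (le_trans (mgf_prod_le P mlX mtY _)).
    move=> w w'; rewrite -!mulrBr [leLHS]normrM [leRHS]normrM (ger0_norm l0).
    rewrite (ger0_norm (divr_ge0 l0 (ltW kappa_gt0))) -mulrA ler_wpM2l//.
    by rewrite mulrC ler_pdivlMr// mulrC.
  rewrite (Y_mgf thk').
  have := @Y_mgf (- theta); rewrite ltrNl => /(_ thNk).
  under eq_fun do rewrite mulNr.
  move=> ->; rewrite -EFinM lee_fin.
  under [X in _ * X]eq_bigr do rewrite opprK.
  apply: (le_trans (prod_order_mgf_le k_gt0 thk)).
  by rewrite ler_expR.
rewrite -lee_expeR lneK ?in_itv/= ?M0 ?leey//.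
Qed.

End abs_gaussian_median.

Theorem proposition4p6 (d : measure_display) (T : measurableType d)
    (R : realType) (P : probability T R) (n : nat)
    (G : 'I_n -> {RV P >-> R}) (hn : (2 <= n)%N) (n_even : ~~ odd n)
    (G_indep : mutually_independent G)
    (G_gauss : forall i, standard_gaussian (G i)) :
  let v : R := vn R n in
  let X : T -> R := abs_median G in
  let EX : R := fine 'E_P[X] in
  (forall lambda : R, 0 <= lambda ->
    lambda < Num.sqrt n%:R / (2 * Num.sqrt v) ->
    (lne 'E_P[fun w => expR (lambda * (X w - EX))] <=
     (v * lambda ^+ 2 / (2 * (1 - 2 * lambda * Num.sqrt (v / n%:R))))%:E)%E)
  /\
  (forall t : R, 0 < t ->
    (P [set w | X w - EX > Num.sqrt (2 * v * t)
                           + 2 * Num.sqrt (v / n%:R) * t]%R <=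
     (expR (- t))%:E)%E).
Proof.
move=> v X EX; rewrite /EX /X /v {v X EX}.
have [k nk] : exists k, n = k.*2 by exists n./2; rewrite even_halfK.
move: G hn n_even G_indep G_gauss; rewrite nk => {n nk} G hn _ G_indep G_gauss.
have k0 : (0 < k)%N by rewrite -double_gt0 (leq_trans _ hn).
set v := vn R k.*2; set X := abs_median G; set EX := fine _.
have n0 : 0 < k.*2%:R :> R by rewrite ltr0n double_gt0.
have v0 : 0 < v by rewrite divr_gt0// mulr_gt0// ln_gt0// ltr1n.
have mgf := abs_median_mgf_le k0 G_indep G_gauss.
split=> [lambda l0 l1|].
  (* The assumed range of [lambda] is the condition [2 * lambda * sqrt (v / n) < 1]. *)
  apply: mgf => //; rewrite -/v sqrtrM ?(ltW v0)// sqrtrV ?ler0n//.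
  move: l1; rewrite ltr_pdivlMr ?mulr_gt0 ?sqrtr_gt0// => l1.
  by rewrite mulrA ltr_pdivrMr ?sqrtr_gt0// mul1r (mulrC 2) -mulrA.
have mX : measurable_fun setT (fun w => X w - EX).
  by apply: measurable_funB => //; exact: measurable_abs_median.
pose Z : {RV P >-> R} := mfun_Sub (mem_set mX).
have c0 : 0 < 2 * Num.sqrt (v / k.*2%:R).
  by rewrite mulr_gt0// sqrtr_gt0 divr_gt0.
apply: (@sub_gamma_tail _ _ _ P Z v _ v0 c0) => lambda l0.
rewrite mulrAC => l1; exact: mgf.
Qed.
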